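(* Let $f(z) = e^{2\pi i\alpha}z+O(z^2)$, $\alpha\in\mathbb{R}\setminus\mathbb{Q}$, be a nonlinearizable germ, and let $g$ be a nondegenerate parabolic germ. Then $f$ and $g$ do not commute, i.e. $f\circ g\neq g\circ f$ as germs.
   Context: A germ $f(z)=e^{2\pi i\alpha}z+O(z^2)$ with $\alpha$ irrational is linearizable if there is a holomorphic $h(w)=w+O(w^2)$ with $h^{-1}\circ f\circ h=R_\alpha$, $R_\alpha(w)=e^{2\pi i\alpha}w$; otherwise nonlinearizable. A nondegenerate parabolic germ is a germ $g\in\mathrm{Diff}(\mathbb{C},0)$ with $g'(0)=e^{2\pi i p/q}$ a root of unity (so $g^q$ is tangent to the identity) such that $g^q\neq \mathrm{id}$. *)

(* Defs.v *)
From HB Require Import structures.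
From mathcomp Require Import all_boot all_order all_algebra.
From mathcomp Require Import complex.
From mathcomp Require Import all_classical all_reals all_analysis.
Set Implicit Arguments. Unset Strict Implicit. Unset Printing Implicit Defensive.
Import Order.TTheory GRing.Theory Num.Theory.
Import numFieldNormedType.Exports.
Local Open Scope ring_scope.

(* The complex plane, as a normed module over itself (so that [derivable f z 1]
   is complex differentiability and [derive1] is the complex derivative). *)
Notation Cplx R := ((R[i])^o).

Definition germ_eq (R : realType) (f g : Cplx R -> Cplx R) : Prop :=
  \forall z \near (0 : Cplx R), f z = g z.

Definition holo_near0 (R : realType) (f : Cplx R -> Cplx R) : Prop :=
  \forall z \near (0 : Cplx R), derivable f z 1.

Definition holo_germ (R : realType) (f : Cplx R -> Cplx R) : Prop :=
  f 0 = 0 /\ holo_near0 f.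

Definition rot_mult (R : realType) (alpha : R) : Cplx R :=
  (cos (2 * pi * alpha) +i* sin (2 * pi * alpha))%C.

Definition R_alpha (R : realType) (alpha : R) : Cplx R -> Cplx R :=
  fun w => rot_mult alpha * w.

Definition linearizable (R : realType) (alpha : R) (f : Cplx R -> Cplx R) : Prop :=
  exists h hinv : Cplx R -> Cplx R,
    [/\ holo_germ h /\ derive1 h 0 = 1, holo_germ hinv,
        germ_eq (hinv \o h) id, germ_eq (h \o hinv) id &
        germ_eq (hinv \o f \o h) (R_alpha alpha)].

Definition nondeg_parabolic (R : realType) (g : Cplx R -> Cplx R) : Prop :=
  holo_germ g /\ derive1 g 0 != 0 /\
  exists q : nat, [/\ (0 < q)%N, q.-primitive_root (derive1 g 0) &
                      ~ germ_eq (iter q g) id].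

(* Main.v *)
(**
  Put G = g^q, which is tangent to the identity, commutes with f and differs
  from the identity.  If G(z) - z = d z^n + o(z^n) with d <> 0, then n >= 2 and,
  with l = f'(0), the two sides of f(G(z)) - f(z) = G(f(z)) - f(z) have leading
  terms l d z^n and d l^n z^n.  Hence l^(n-1) = 1, which is impossible for an
  irrational rotation number.

  The order n exists because holomorphic germs are analytic.  To get this from
  complex differentiability alone, the closed form f(z) dz/(z - a) is pulled back
  by z = a + e^x (r e^(it) - a), where it reads f(z) (dx + kappa(t) dt), and
  Goursat's bisection argument on [X, 0] x [0, 2 pi], followed by X -> -oo,
  yields Cauchy's formula.  Expanding the Cauchy kernel in a geometric series
  gives Taylor expansions with remainder at most M (|a|/r)^n, so that a germ whose
  coefficients all vanish is zero.
*)
Require Import Defs.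
From HB Require Import structures.
From mathcomp Require Import all_boot all_order all_algebra.
From mathcomp Require Import complex ring lra.
From mathcomp Require Import all_classical all_reals all_analysis.
Import Order.TTheory GRing.Theory Num.Theory.
Import numFieldNormedType.Exports.
Local Open Scope ring_scope.
Set Implicit Arguments. Unset Strict Implicit. Unset Printing Implicit Defensive.

(** * The modulus and integrals of complex-valued functions *)

Section ComplexIntegral.
Context {R : realType}.
Notation C := R[i].
Notation Re := (@complex.Re R).
Notation Im := (@complex.Im R).
Notation mu := (@lebesgue_measure R).
Implicit Types (f : R -> R) (phi psi : R -> C) (a b c : R) (z w : C).

(* The norm of [R[i]] takes its values in [R[i]]; [cabs] is its real-valued form. *)
Definition cabs z : R := Normc.normc z.

Lemma cabs0 : cabs 0 = 0.
Proof. exact: Normc.normc0. Qed.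

Lemma cabs1 : cabs 1 = 1.
Proof. exact: Normc.normc1. Qed.

Lemma cabsM z w : cabs (z * w) = cabs z * cabs w.
Proof. exact: Normc.normcM. Qed.

Lemma cabsV z : cabs z^-1 = (cabs z)^-1.
Proof. exact: Normc.normcV. Qed.

Lemma ler_cabsD z w : cabs (z + w) <= cabs z + cabs w.
Proof. exact: (@le_normcD R). Qed.

Lemma cabsN z : cabs (- z) = cabs z.
Proof. exact: (@normcN R). Qed.

Lemma cabs_ge0 z : 0 <= cabs z.
Proof. by case: z => x y; exact: sqrtr_ge0. Qed.

Lemma le_Re_cabs z : `|Re z| <= cabs z.
Proof.
case: z => x y /=; rewrite -sqrtr_sqr ler_wsqrtr // lerDl sqr_ge0 //.
Qed.

Lemma le_Im_cabs z : `|Im z| <= cabs z.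
Proof.
case: z => x y /=; rewrite -sqrtr_sqr ler_wsqrtr // lerDr sqr_ge0 //.
Qed.

Lemma cabs_real (x : R) : cabs x%:C%C = `|x|.
Proof. by rewrite /= expr0n /= addr0 sqrtr_sqr. Qed.

Lemma cabs_le_ReIm z : cabs z <= `|Re z| + `|Im z|.
Proof.
case: z => x y /=; rewrite -[leRHS]ger0_norm ?addr_ge0 // -sqrtr_sqr.
rewrite ler_wsqrtr // -(real_normK (num_real x)) -(real_normK (num_real y)).
rewrite sqrrD; have := normr_ge0 x; have := normr_ge0 y; nra.
Qed.

Lemma cabs_eq0 z : (cabs z == 0) = (z == 0).
Proof. by apply/eqP/eqP => [/Normc.eq0_normc //|->]; rewrite cabs0. Qed.

Lemma cabs_gt0 z : (0 < cabs z) = (z != 0).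
Proof. by rewrite lt0r cabs_ge0 andbT cabs_eq0. Qed.

Lemma cabsX z n : cabs (z ^+ n) = cabs z ^+ n.
Proof. by elim: n => [|n IH]; rewrite ?expr0 ?cabs1 // !exprS cabsM IH. Qed.

Lemma cabsBC z w : cabs (z - w) = cabs (w - z).
Proof. by rewrite -cabsN opprB. Qed.

(** * Continuity of complex-valued functions of a real variable *)

Definition ccont phi :=
  continuous (fun t => Re (phi t)) /\ continuous (fun t => Im (phi t)).

Lemma ccontP phi : ccont phi <->
  forall t e, 0 < e -> \forall s \near t, cabs (phi s - phi t) < e.
Proof.
split=> [[cR cI] t e e0|H].
  have e20 : 0 < e / 2 by rewrite divr_gt0.
  have /cvgrPdist_lt /(_ _ e20) HR := cR t.
  have /cvgrPdist_lt /(_ _ e20) HI := cI t.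
  near=> s; apply: le_lt_trans (cabs_le_ReIm _) _.
  rewrite [e]splitr ltrD //.
    rewrite raddfB /= distrC; near: s; exact: HR.
  rewrite raddfB /= distrC; near: s; exact: HI.
split=> t; apply/cvgrPdist_lt => e e0; near=> s.
  have -> : Re (phi t) - Re (phi s) = - Re (phi s - phi t) by rewrite raddfB opprB.
  rewrite normrN; apply: le_lt_trans (le_Re_cabs _) _.
  by near: s; exact: H.
have -> : Im (phi t) - Im (phi s) = - Im (phi s - phi t) by rewrite raddfB opprB.
rewrite normrN; apply: le_lt_trans (le_Im_cabs _) _.
by near: s; exact: H.
Unshelve. all: by end_near. Qed.

Lemma eq_ccont phi psi : phi =1 psi -> ccont phi -> ccont psi.
Proof. by move=> /funext ->. Qed.

Lemma ccont_cst z : ccont (fun=> z).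
Proof. by split=> t; exact: cvg_cst. Qed.

Lemma ccontD phi psi : ccont phi -> ccont psi -> ccont (fun t => phi t + psi t).
Proof.
move=> [a1 a2] [b1 b2]; split=> t.
  have -> : (fun t => Re (phi t + psi t)) = (fun t => Re (phi t) + Re (psi t)).
    by apply: funext => s; rewrite raddfD.
  by apply: cvgD; [exact: a1|exact: b1].
have -> : (fun t => Im (phi t + psi t)) = (fun t => Im (phi t) + Im (psi t)).
  by apply: funext => s; rewrite raddfD.
by apply: cvgD; [exact: a2|exact: b2].
Qed.

Lemma ccontM phi psi : ccont phi -> ccont psi -> ccont (fun t => phi t * psi t).
Proof.
move=> [a1 a2] [b1 b2]; split=> t.
  have -> : (fun t => Re (phi t * psi t)) =
      (fun t => Re (phi t) * Re (psi t) - Im (phi t) * Im (psi t)).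
    by apply: funext => s; case: (phi s) (psi s) => [? ?] [].
  apply: cvgB; apply: cvgM; [exact: a1|exact: b1|exact: a2|exact: b2].
have -> : (fun t => Im (phi t * psi t)) =
    (fun t => Re (phi t) * Im (psi t) + Im (phi t) * Re (psi t)).
  by apply: funext => s; case: (phi s) (psi s) => [? ?] [].
apply: cvgD; apply: cvgM; [exact: a1|exact: b2|exact: a2|exact: b1].
Qed.

Lemma ccontN phi : ccont phi -> ccont (fun t => - phi t).
Proof.
move=> c; apply: (@eq_ccont (fun t => -1 * phi t)) => [t|].
  by rewrite mulN1r.
by apply: ccontM => //; exact: ccont_cst.
Qed.

Lemma ccontB phi psi : ccont phi -> ccont psi -> ccont (fun t => phi t - psi t).
Proof. by move=> h k; apply: ccontD => //; exact: ccontN. Qed.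

Lemma ccontX phi n : ccont phi -> ccont (fun t => phi t ^+ n).
Proof.
move=> h; elim: n => [|n IH].
  by apply: (eq_ccont _ (ccont_cst 1)) => t; rewrite expr0.
by apply: (eq_ccont _ (ccontM h IH)) => t; rewrite exprS.
Qed.

Lemma ccontV phi : (forall t, phi t != 0) -> ccont phi ->
  ccont (fun t => (phi t)^-1).
Proof.
move=> nz [a1 a2].
have n0 t : Re (phi t) ^+ 2 + Im (phi t) ^+ 2 != 0.
  apply: contraNneq (nz t) => /eqP.
  rewrite paddr_eq0 ?sqr_ge0 // !sqrf_eq0.
  by case: (phi t) => x y /= /andP[/eqP -> /eqP ->].
have cN : continuous (fun t => (Re (phi t) ^+ 2 + Im (phi t) ^+ 2)^-1).
  move=> t; apply: cvgV => //.
  by apply: cvgD; apply: cvgM; [exact: a1|exact: a1|exact: a2|exact: a2].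
split=> t.
  have -> : (fun t => Re (phi t)^-1) =
      (fun t => Re (phi t) * (Re (phi t) ^+ 2 + Im (phi t) ^+ 2)^-1).
    by apply: funext => s; case: (phi s).
  by apply: cvgM; [exact: a1|exact: cN].
have -> : (fun t => Im (phi t)^-1) =
    (fun t => - (Im (phi t) * (Re (phi t) ^+ 2 + Im (phi t) ^+ 2)^-1)).
  by apply: funext => s; case: (phi s).
by apply: cvgN; apply: cvgM; [exact: a2|exact: cN].
Qed.

Lemma ccont_real f : continuous f -> ccont (fun t => (f t)%:C%C).
Proof. by move=> cf; split=> t; [exact: cf|exact: cvg_cst]. Qed.

(** * Integrals over a segment and primitives *)

Lemma continuous_itv_integrable f a b : continuous f ->
  mu.-integrable `[a, b] (EFin \o f).
Proof.
move=> cf; apply: continuous_compact_integrable; first exact: segment_compact.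
by apply: continuous_subspaceT => x; exact: cf.
Qed.

(** The integral is over a set, hence unoriented: it is 0 when b < a. Additivity, the bounds and the
    fundamental theorem below therefore assume ordered endpoints. *)
Definition cint a b phi : C :=
  ((\int[mu]_(t in `[a, b]) Re (phi t)) +i* (\int[mu]_(t in `[a, b]) Im (phi t)))%C.

Lemma eq_cint a b phi psi : (forall t, a <= t <= b -> phi t = psi t) ->
  cint a b phi = cint a b psi.
Proof.
move=> e; congr (_ +i* _)%C; apply: eq_Rintegral => t;
  by rewrite inE /= in_itv /= => /e ->.
Qed.

Lemma cintD a b phi psi : ccont phi -> ccont psi ->
  cint a b (fun t => phi t + psi t) = cint a b phi + cint a b psi.
Proof.
move=> [a1 a2] [b1 b2]; apply/eqP; rewrite eq_complex /=; apply/andP; split; apply/eqP.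
  under eq_Rintegral do rewrite raddfD.
  by rewrite RintegralD //; apply: continuous_itv_integrable.
under eq_Rintegral do rewrite raddfD.
by rewrite RintegralD //; apply: continuous_itv_integrable.
Qed.

Lemma cintZ a b z phi : ccont phi ->
  cint a b (fun t => z * phi t) = z * cint a b phi.
Proof.
case: z => x y [a1 a2].
have ci (g : R -> R) : continuous g -> mu.-integrable `[a, b] (EFin \o g).
  exact: continuous_itv_integrable.
have cz (r : R) (g : R -> R) : continuous g -> continuous (fun t => r * g t).
  by move=> cg t; apply: cvgM; [exact: cvg_cst|exact: cg].
apply/eqP; rewrite eq_complex /=; apply/andP; split; apply/eqP.
  under eq_Rintegral => t _.
    have -> : Re ((x +i* y)%C * phi t) = x * Re (phi t) - y * Im (phi t).
      by case: (phi t).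
    over.
  rewrite RintegralB ?RintegralZl //; apply: ci => //; exact: cz.
under eq_Rintegral => t _.
  have -> : Im ((x +i* y)%C * phi t) = x * Im (phi t) + y * Re (phi t).
    by case: (phi t).
  over.
rewrite RintegralD ?RintegralZl //; apply: ci => //; exact: cz.
Qed.

Lemma cintB a b phi psi : ccont phi -> ccont psi ->
  cint a b (fun t => phi t - psi t) = cint a b phi - cint a b psi.
Proof.
move=> c1 c2; rewrite cintD //; last exact: ccontN.
congr (_ + _); rewrite -mulN1r -cintZ //.
by apply: eq_cint => t _; rewrite mulN1r.
Qed.

Lemma cint_cat a b c phi : ccont phi -> a <= b -> b <= c ->
  cint a c phi = cint a b phi + cint b c phi.
Proof.
move=> [a1 a2] ab bc.
have H (h : R -> R) : continuous h -> \int[mu]_(t in `[a, c]) h t =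
    \int[mu]_(t in `[a, b]) h t + \int[mu]_(t in `[b, c]) h t.
  (* The difference of two of the integrals is an integral over the half-open interval from b to c;
     the missing endpoint b has measure zero. *)
  move=> cf; have := @Rintegral_itvB R h (BLeft a) (BRight c) b.
  move=> /(_ (continuous_itv_integrable a c cf)).
  rewrite !bnd_simp => /(_ ab bc) e.
  rewrite -(@Rintegral_itv_obnd_cbnd _ b) -?e ?subrKC //.
  apply: integrableS (continuous_itv_integrable b c cf) => //.
  by apply: subset_itvr; rewrite bnd_simp.
by rewrite /cint !H.
Qed.

Lemma norm_Rintegral_itv_le f a b K : continuous f -> a <= b ->
  (forall t, a <= t <= b -> `|f t| <= K) ->
  `|\int[mu]_(t in `[a, b]) f t| <= K * (b - a).
Proof.
move=> cf ab fK; apply: le_trans (le_normr_Rintegral _ _) _ => //.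
  exact: continuous_itv_integrable.
have cn : continuous (fun t => `|f t|).
  by move=> t; apply: cvg_norm; exact: cf.
have cK : continuous (fun _ : R => K) by move=> t; exact: cvg_cst.
apply: le_trans (le_Rintegral _ _ _ _) _ => //.
- exact: (continuous_itv_integrable a b cn).
- exact: (continuous_itv_integrable a b cK).
- by move=> t /=; rewrite in_itv /=; exact: fK.
rewrite Rintegral_cst //= [X in fine X](@lebesgue_measure_itv R `[a, b]) /= lte_fin.
by case: ltgtP ab => [||->]; rewrite ?subrr ?mulr0.
Qed.

(** Real and imaginary parts are bounded separately, which costs a factor 2 over the sharp bound.
    This 2 reappears in the constants below. *)
Lemma cabs_cint_le a b phi K : ccont phi -> a <= b ->
  (forall t, a <= t <= b -> cabs (phi t) <= K) ->
  cabs (cint a b phi) <= 2 * K * (b - a).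
Proof.
move=> [a1 a2] ab H; apply: le_trans (cabs_le_ReIm _) _ => /=.
rewrite mulr2n !mulrDl !mul1r; apply: lerD; apply: norm_Rintegral_itv_le => // t /H.
  exact/le_trans/le_Re_cabs.
exact/le_trans/le_Im_cabs.
Qed.

Definition is_cderive phi psi := forall t : R,
  is_derive t (1 : R) (fun s => Re (phi s)) (Re (psi t)) /\
  is_derive t (1 : R) (fun s => Im (phi s)) (Im (psi t)).

Lemma is_cderive_ccont phi psi : is_cderive phi psi -> ccont phi.
Proof.
move=> d; split=> t; apply: differentiable_continuous; apply/derivable1_diffP.
  by have [[]] := d t.
by have [_ []] := d t.
Qed.

Lemma Rintegral_itv_FTC (F f : R -> R) a b : a <= b -> continuous f ->
  (forall t : R, is_derive t (1 : R) F (f t)) ->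
  \int[mu]_(t in `[a, b]) f t = F b - F a.
Proof.
rewrite le_eqVlt => /predU1P[-> _ _|ab cf dF].
  by rewrite set_itv1 Rintegral_set1 subrr.
have cF : continuous F.
  move=> t; apply: differentiable_continuous; apply/derivable1_diffP.
  by have [] := dF t.
rewrite /Rintegral (continuous_FTC2 ab (F := F)) //.
- by apply: continuous_subspaceT => x; exact: cf.
- split; last 2 first.
  + by apply: cvg_at_right_filter; exact: cF.
  + by apply: cvg_at_left_filter; exact: cF.
  + by move=> x _; have [] := dF x.
- by move=> x _; rewrite derive1E; have [] := dF x.
Qed.

Lemma cint_FTC phi psi a b : a <= b -> ccont psi -> is_cderive phi psi ->
  cint a b psi = phi b - phi a.
Proof.
move=> ab [c1 c2] d.
apply/eqP; rewrite eq_complex /= !raddfB /=; apply/andP; split; apply/eqP.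
  exact: (Rintegral_itv_FTC ab c1 (fun t => (d t).1)).
exact: (Rintegral_itv_FTC ab c2 (fun t => (d t).2)).
Qed.

End ComplexIntegral.

(** * Goursat's bisection *)

Section Bisection.
Context {R : realType}.
Notation C := R[i].
Variables (J : R -> R -> R -> R -> C) (X1 X2 Y1 Y2 : R).

Hypothesis J_catx : forall x1 x2 x3 y1 y2, x1 <= x2 -> x2 <= x3 -> y1 <= y2 ->
  J x1 x3 y1 y2 = J x1 x2 y1 y2 + J x2 x3 y1 y2.
Hypothesis J_caty : forall x1 x2 y1 y2 y3, x1 <= x2 -> y1 <= y2 -> y2 <= y3 ->
  J x1 x2 y1 y3 = J x1 x2 y1 y2 + J x1 x2 y2 y3.

Let size (q : R * R * R * R) : R :=
  let: (x1, x2, y1, y2) := q in (x2 - x1) + (y2 - y1).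
Let ordered (q : R * R * R * R) : Prop :=
  let: (x1, x2, y1, y2) := q in x1 <= x2 /\ y1 <= y2.
Let val (q : R * R * R * R) : R :=
  let: (x1, x2, y1, y2) := q in cabs (J x1 x2 y1 y2).
Let sub (p q : R * R * R * R) : Prop :=
  let: (x1, x2, y1, y2) := p in let: (x1', x2', y1', y2') := q in
  [/\ x1' <= x1, x2 <= x2', y1' <= y1 & y2 <= y2'].

(** Halving the semi-perimeter [size] divides e * size ^ 2 by four. If all four quarters obeyed the
    bound, the triangle inequality would give it for the whole rectangle. *)
Let quarter e q : ordered q -> e * size q ^+ 2 < val q ->
  exists p, [/\ ordered p, e * size p ^+ 2 < val p, sub p q & size p = size q / 2].
Proof.
case: q => [[[x1 x2] y1] y2] /= [x12 y12] big.
pose x := (x1 + x2) / 2; pose y := (y1 + y2) / 2.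
have [x1x xx2 y1y yy2] : [/\ x1 <= x, x <= x2, y1 <= y & y <= y2].
  by rewrite /x /y; split; lra.
have split4 : J x1 x2 y1 y2 =
    (J x1 x y1 y + J x1 x y y2) + (J x x2 y1 y + J x x2 y y2).
  by rewrite (J_catx x1x xx2 y12) (J_caty x1x y1y yy2) (J_caty xx2 y1y yy2).
pose s := (x2 - x1) + (y2 - y1).
have : [\/ e * (s / 2) ^+ 2 < cabs (J x1 x y1 y), e * (s / 2) ^+ 2 < cabs (J x1 x y y2),
    e * (s / 2) ^+ 2 < cabs (J x x2 y1 y) | e * (s / 2) ^+ 2 < cabs (J x x2 y y2)].
  have [?|h1] := ltP (e * (s / 2) ^+ 2) (cabs (J x1 x y1 y)); first by constructor 1.
  have [?|h2] := ltP (e * (s / 2) ^+ 2) (cabs (J x1 x y y2)); first by constructor 2.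
  have [?|h3] := ltP (e * (s / 2) ^+ 2) (cabs (J x x2 y1 y)); first by constructor 3.
  have [?|h4] := ltP (e * (s / 2) ^+ 2) (cabs (J x x2 y y2)); first by constructor 4.
  exfalso; move: big; rewrite -/s split4 => big.
  have t0 := ler_cabsD (J x1 x y1 y + J x1 x y y2) (J x x2 y1 y + J x x2 y y2).
  have t1 := ler_cabsD (J x1 x y1 y) (J x1 x y y2).
  have t2 := ler_cabsD (J x x2 y1 y) (J x x2 y y2).
  have es : e * s ^+ 2 = 4 * (e * (s / 2) ^+ 2) by field.
  rewrite es in big; lra.
case=> h.
- exists (x1, x, y1, y) => /=; rewrite (_ : _ + _ = s / 2) ?lexx //.
  by rewrite /s /x /y; field.
- exists (x1, x, y, y2) => /=; rewrite (_ : _ + _ = s / 2) ?lexx //.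
  by rewrite /s /x /y; field.
- exists (x, x2, y1, y) => /=; rewrite (_ : _ + _ = s / 2) ?lexx //.
  by rewrite /s /x /y; field.
- exists (x, x2, y, y2) => /=; rewrite (_ : _ + _ = s / 2) ?lexx //.
  by rewrite /s /x /y; field.
Qed.

(* If [J] were nonzero, one of four quarters would keep [cabs J > e * size ^ 2],
   and so on forever; the nested rectangles shrink to a point violating the
   local estimate. *)
Lemma bisection_eq0 : X1 <= X2 -> Y1 <= Y2 ->
  (forall px py, X1 <= px <= X2 -> Y1 <= py <= Y2 -> forall e, 0 < e ->
    exists2 d, 0 < d & forall x1 x2 y1 y2, X1 <= x1 <= px -> px <= x2 <= X2 ->
      Y1 <= y1 <= py -> py <= y2 <= Y2 -> (x2 - x1) + (y2 - y1) < d ->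
      cabs (J x1 x2 y1 y2) <= e * ((x2 - x1) + (y2 - y1)) ^+ 2) ->
  J X1 X2 Y1 Y2 = 0.
Proof.
move=> X12 Y12 loc; apply/eqP; rewrite -cabs_eq0; apply/negPn/negP => J0.
have {J0} J0 : 0 < cabs (J X1 X2 Y1 Y2) by rewrite lt0r J0 cabs_ge0.
pose q0 := (X1, X2, Y1, Y2); pose S := size q0.
have S1 : 0 < S ^+ 2 + 1 by rewrite ltr_wpDl ?sqr_ge0.
(* The added 1 makes the initial violation strict and keeps the division legitimate for a rectangle
   of size 0. *)
pose e := cabs (J X1 X2 Y1 Y2) / (S ^+ 2 + 1).
have e0 : 0 < e by rewrite divr_gt0.
have bad0 : e * size q0 ^+ 2 < val q0.
  rewrite -/S /= /e mulrAC ltr_pdivrMr // ltr_pM2l //; lra.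
(* To obtain a total function, a rectangle that is not a violating one is sent to itself, where the
   implication is vacuous. *)
have /choice [step stepP] : forall q, exists p, ordered q /\ e * size q ^+ 2 < val q ->
    [/\ ordered p, e * size p ^+ 2 < val p, sub p q & size p = size q / 2].
  move=> q.
  have [qP|] := pselect (ordered q /\ e * size q ^+ 2 < val q); last by exists q.
  by have [p hp] := quarter qP.1 qP.2; exists p.
pose Q n := iter n step q0.
have Qgood n : ordered (Q n) /\ e * size (Q n) ^+ 2 < val (Q n).
  by elim: n => [|n IH]; [|have [] := stepP _ IH].
have Qsize n : size (Q n) = S / 2 ^+ n.
  elim: n => [|n IH]; first by rewrite expr0 divr1.
  have [_ _ _] := stepP _ (Qgood n).
  by rewrite IH exprSr invfM mulrA => ->.
have subt p q r : sub p q -> sub q r -> sub p r.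
  case: p q r => [[[? ?] ?] ?] [[[? ?] ?] ?] [[[? ?] ?] ?] /=.
  by case=> ? ? ? ? [? ? ? ?]; split; lra.
have Qsub n m : sub (Q (m + n)%N) (Q n).
  elim: m => [|m IH].
    by rewrite add0n; case: (Q n) => [[[? ?] ?] ?] /=; rewrite !lexx.
  by have [_ _ h _] := stepP _ (Qgood (m + n)%N); apply: subt h IH.
pose x1 n := (Q n).1.1.1; pose x2 n := (Q n).1.1.2.
pose y1 n := (Q n).1.2; pose y2 n := (Q n).2.
have QE n : Q n = (x1 n, x2 n, y1 n, y2 n).
  by rewrite /x1 /x2 /y1 /y2; case: (Q n) => [[[? ?] ?] ?].
(* [Q (m + n)] lies in both [Q n] and [Q m], so every lower bound of a side is below every upper
   bound. The suprema of the lower bounds then belong to all the rectangles. *)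
have cross n m : x1 n <= x2 m /\ y1 n <= y2 m.
  have h1 := Qsub n m; have h2 := Qsub m n; have [oq _] := Qgood (m + n)%N.
  move: h1 h2 oq; rewrite [(n + m)%N]addnC !QE /= => -[? ? ? ?] [? ? ? ?] [? ?].
  by split; lra.
pose px := sup (range x1); pose py := sup (range y1).
have nx n : x1 n <= px <= x2 n.
  rewrite ub_le_sup /=; last 2 first.
  - by exists (x2 0) => _ [m _ <-]; have [] := cross m 0%N.
  - by exists n.
  by apply: ge_sup; [exists (x1 0), 0%N|move=> _ [m _ <-]; have [] := cross m n].
have ny n : y1 n <= py <= y2 n.
  rewrite ub_le_sup /=; last 2 first.
  - by exists (y2 0) => _ [m _ <-]; have [] := cross m 0%N.
  - by exists n.
  by apply: ge_sup; [exists (y1 0), 0%N|move=> _ [m _ <-]; have [] := cross m n].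
have [d d0 dP] := loc px py (nx 0%N) (ny 0%N) e e0.
have [n Sn] : exists n, S / 2 ^+ n < d.
  have S0 : 0 <= S by rewrite /S /=; lra.
  exists (Num.bound (S / d)).
  rewrite ltr_pdivrMr ?exprn_gt0 // mulrC -ltr_pdivrMr //.
  apply: lt_trans (archi_boundP _) _; first by rewrite divr_ge0 // ltW.
  by rewrite -natrX ltr_nat ltn_expl.
have [_] := Qgood n; have sn := Qsize n.
have := Qsub 0%N n; rewrite addn0 QE => -[/= a1 a2 a3 a4].
move: sn (nx n) (ny n); rewrite QE /= => sn /andP[b1 b2] /andP[b3 b4].
by rewrite ltNge dP // ?sn // ?a1 ?a2 ?a3 ?a4 ?b1 ?b2 ?b3 ?b4.
Qed.

End Bisection.

(** * Complex differentiability and the unit circle *)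

Section ComplexDifferentiability.
Context {R : realType}.
Notation C := R[i].
Implicit Types (f g : C -> C) (gam : R -> C) (z w D : C).

Definition ccont_at f z := forall e, 0 < e -> exists2 d, 0 < d &
  forall w, cabs (w - z) < d -> cabs (f w - f z) < e.

(** The difference quotient is multiplied out, so that w = z does not have to be excluded. *)
Definition is_cdiff f z D := forall e, 0 < e -> exists2 d, 0 < d &
  forall w, cabs (w - z) < d -> cabs (f w - f z - D * (w - z)) <= e * cabs (w - z).

Lemma is_cdiff_cont f z D : is_cdiff f z D -> ccont_at f z.
Proof.
move=> df e e0; have [d d0 dP] := df 1 ltr01.
have K0 : 0 < 1 + cabs D by rewrite ltr_wpDr ?cabs_ge0.
exists (Num.min d (e / (1 + cabs D))); first by rewrite lt_min d0 divr_gt0.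
move=> w; rewrite lt_min ltr_pdivlMr // => /andP[/dP h1 h2].
rewrite -[f w - f z](subrK (D * (w - z))).
apply: le_lt_trans (ler_cabsD _ _) _; rewrite cabsM.
by apply: le_lt_trans h2; rewrite mul1r in h1; nra.
Qed.

Lemma ccont_comp f gam : (forall t, ccont_at f (gam t)) -> ccont gam ->
  ccont (fun t => f (gam t)).
Proof.
move=> cf /ccontP cg; apply/ccontP => t e e0.
have [d d0 dP] := cf t e e0; near=> s; apply: dP; near: s; exact: cg.
Unshelve. all: by end_near. Qed.

Definition expi (t : R) : C := (cos t +i* sin t)%C.

Lemma expi0 : expi 0 = 1.
Proof. by rewrite /expi cos0 sin0. Qed.

Lemma expiD s t : expi (s + t) = expi s * expi t.
Proof.
by rewrite /expi cosD sinD; apply/eqP; rewrite eq_complex /= addrC eqxx addrC eqxx.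
Qed.

Lemma expi_nat t n : expi (n%:R * t) = expi t ^+ n.
Proof.
elim: n => [|n IH]; first by rewrite mul0r expi0.
by rewrite -natr1 mulrDl mul1r expiD IH exprSr.
Qed.

Lemma cabs_expi t : cabs (expi t) = 1.
Proof. by rewrite /cabs /= cos2Dsin2 sqrtr1. Qed.

Lemma expi_neq0 t : expi t != 0.
Proof. by rewrite -cabs_gt0 cabs_expi. Qed.

Lemma expi_2pi : expi (2 * pi) = 1.
Proof. by rewrite mulr_natl /expi cos2pi sin2pi. Qed.

Lemma is_cderive_expi (k : R) :
  is_cderive (fun t => expi (k * t)) (fun t => 'i%C * k%:C%C * expi (k * t)).
Proof.
move=> t; rewrite /expi /=; simpc; split.
  by apply: is_derive_eq; rewrite /GRing.scale /=; ring.
by apply: is_derive_eq; rewrite /GRing.scale /=; ring.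
Qed.

Lemma ccont_expi (k : R) : ccont (fun t => expi (k * t)).
Proof. exact: is_cderive_ccont (is_cderive_expi k). Qed.

End ComplexDifferentiability.

(** * Cauchy's formula on a circle *)

Section CauchyCircle.
Context {R : realType}.
Notation C := R[i].

Variables (r : R) (a : C).
Hypothesis ar : cabs a < r.

Definition circ (t : R) : C := r%:C%C * expi t.

(* [z / (z - a)] on the circle: [dz / (z - a)] is ['i * cauchy_kernel t dt]. *)
Definition cauchy_kernel (t : R) : C := circ t / (circ t - a).

Let r0 : 0 < r. Proof. exact: le_lt_trans (cabs_ge0 a) ar. Qed.

Lemma cabs_circ t : cabs (circ t) = r.
Proof. by rewrite cabsM cabs_expi mulr1 cabs_real gtr0_norm. Qed.

Lemma circ_neq0 t : circ t != 0.
Proof. by rewrite -cabs_gt0 cabs_circ. Qed.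

Lemma cabs_circB_ge t : r - cabs a <= cabs (circ t - a).
Proof.
rewrite lerBlDr -{1}(cabs_circ t) -{1}[circ t](subrK a); exact: ler_cabsD.
Qed.

Lemma circB_neq0 t : circ t - a != 0.
Proof. by rewrite -cabs_gt0 (lt_le_trans _ (cabs_circB_ge t)) // subr_gt0. Qed.

Lemma ccont_circ : ccont circ.
Proof.
apply: ccontM; first exact: ccont_cst.
by apply: eq_ccont (ccont_expi 1) => t; rewrite mul1r.
Qed.

Lemma ccont_circB : ccont (fun t => circ t - a).
Proof. by apply: ccontB; [exact: ccont_circ|exact: ccont_cst]. Qed.

Lemma ccont_kernel : ccont cauchy_kernel.
Proof.
apply: ccontM; first exact: ccont_circ.
by apply: ccontV; [exact: circB_neq0|exact: ccont_circB].
Qed.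

Lemma cabs_kernel_le t : cabs (cauchy_kernel t) <= r / (r - cabs a).
Proof.
rewrite cabsM cabsV cabs_circ ler_pM2l // lef_pV2 ?cabs_circB_ge //.
  by rewrite posrE cabs_gt0 circB_neq0.
by rewrite posrE subr_gt0.
Qed.

Lemma circ_periodic : circ (2 * pi) = circ 0.
Proof. by rewrite /circ expi_2pi expi0. Qed.

Lemma is_cderive_circB : is_cderive (fun t => circ t - a) (fun t => 'i%C * circ t).
Proof.
move=> t; case: a => x y; rewrite /circ /expi /=; simpc; split.
  by apply: is_derive_eq; rewrite /GRing.scale /=; ring.
by apply: is_derive_eq; rewrite /GRing.scale /=; ring.
Qed.

(** The increment is the integral of the derivative 'i * circ, whose modulus is r; the 2 comes from
    [cabs_cint_le]. *)
Lemma circ_lipschitz s t : cabs (circ s - circ t) <= 2 * r * `|s - t|.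
Proof.
wlog ts : s t / t <= s => [H|].
  by have /orP[/H //|/H] := le_total t s; rewrite cabsBC distrC.
have -> : circ s - circ t = (circ s - a) - (circ t - a) by ring.
have ci : ccont (fun t => 'i%C * circ t).
  by apply: ccontM; [exact: ccont_cst|exact: ccont_circ].
rewrite -(cint_FTC ts ci is_cderive_circB) ger0_norm ?subr_ge0 //.
apply: cabs_cint_le => // u _; rewrite cabsM cabs_circ.
by rewrite [cabs _]/= /cabs /= expr0n expr1n add0r sqrtr1 mul1r.
Qed.

(** For y <= x <= 0, write e^x - e^y = e^x (1 - e^(y - x)) and use e^x <= 1 and 1 + (y - x) <= e^(y
    - x). *)
Lemma expR_lipschitz (x y : R) : x <= 0 -> y <= 0 -> `|expR x - expR y| <= `|x - y|.
Proof.
wlog yx : x y / y <= x => [H x0 y0|x0 y0].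
  have /orP[/H|/H {H}] := le_total y x; first exact.
  by move=> H; rewrite distrC (distrC x y); exact: H.
rewrite !ger0_norm ?subr_ge0 ?ler_expR //.
have -> : expR x - expR y = expR x * (1 - expR (y - x)).
  by rewrite mulrBr mulr1 -expRD subrKC.
have e1 : expR x <= 1 by rewrite -expR0 ler_expR.
have e2 := expR_ge1Dx (y - x).
have e3 : expR (y - x) <= 1 by rewrite -expR0 ler_expR subr_le0.
apply: le_trans (_ : 1 - expR (y - x) <= _); last by lra.
by rewrite ler_piMl // subr_ge0.
Qed.

Variables (f : C -> C) (rho : R).
Hypothesis r_rho : r < rho.
Hypothesis f_diff : forall z, cabs z < rho -> exists D, is_cdiff f z D.

(* [clamp x = min x 0]: it makes [u] below continuous on the whole line although
   [f] is only controlled on the ball, that is for [x <= 0]. *)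
Let clamp (x : R) : R := (x - `|x|) / 2.

Let clamp_le0 x : clamp x <= 0.
Proof. by rewrite /clamp; have := ler_norm x; lra. Qed.

Let clampE x : x <= 0 -> clamp x = x.
Proof. by move=> x0; rewrite /clamp ler0_norm // opprK; field. Qed.

Let continuous_clamp : continuous clamp.
Proof.
move=> x; apply: cvgM; last exact: cvg_cst.
by apply: cvgB; [exact: cvg_id|apply: cvg_norm; exact: cvg_id].
Qed.

(** A contraction of the circle towards a: x = 0 gives the circle itself, and x -> -oo gives the
    point a. *)
Let pt (x t : R) : C := a + (expR x)%:C%C * (circ t - a).

Let u (x t : R) : C := f (pt (clamp x) t).

(** For x <= 0 the point is a convex combination of a and [circ t], so its modulus is at most r. *)
Let pt_ball x t : x <= 0 -> cabs (pt x t) < rho.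
Proof.
move=> x0; apply: le_lt_trans r_rho.
have e1 : expR x <= 1 by rewrite -expR0 ler_expR.
have e0 := expR_gt0 x.
have -> : pt x t = (1 - expR x)%:C%C * a + (expR x)%:C%C * circ t.
  by rewrite /pt rmorphB /=; ring.
apply: le_trans (ler_cabsD _ _) _; rewrite 2!cabsM !cabs_real cabs_circ.
rewrite !ger0_norm ?subr_ge0 ?(ltW e0) //.
have : 0 <= (1 - expR x) * (r - cabs a) by rewrite mulr_ge0 // subr_ge0 // ltW.
nra.
Qed.

Let pt_lipschitz x x' t t' : x <= 0 -> x' <= 0 ->
  cabs (pt x t - pt x' t') <= 2 * r * (`|x - x'| + `|t - t'|).
Proof.
move=> x0 x0'.
have -> : pt x t - pt x' t' =
    (expR x - expR x')%:C%C * (circ t - a) + (expR x')%:C%C * (circ t - circ t').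
  by rewrite /pt rmorphB /=; ring.
apply: le_trans (ler_cabsD _ _) _; rewrite !cabsM !cabs_real mulrDr.
have e1 : expR x' <= 1 by rewrite -expR0 ler_expR.
have e0 := expR_gt0 x'.
apply: lerD.
  rewrite mulrC; apply: ler_pM; rewrite ?cabs_ge0 ?normr_ge0 ?expR_lipschitz //.
  apply: le_trans (ler_cabsD _ _) _; rewrite cabs_circ cabsN.
  by rewrite mulr_natl mulr2n lerD2l ltW.
rewrite gtr0_norm //; apply: le_trans (circ_lipschitz t t').
by rewrite ler_piMl ?cabs_ge0.
Qed.

Let f_cont z : cabs z < rho -> ccont_at f z.
Proof. by move=> /f_diff[D /is_cdiff_cont]. Qed.

Let ccont_ux t : ccont (fun x => u x t).
Proof.
apply: ccont_comp => [x|]; first by apply/f_cont/pt_ball/clamp_le0.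
apply: ccontD; first exact: ccont_cst.
apply: ccontM; last exact: ccont_cst.
apply: ccont_real => x.
by apply: (continuous_comp (@continuous_clamp x)); exact: continuous_expR.
Qed.

Let ccont_ut x : ccont (fun t => u x t).
Proof.
apply: ccont_comp => [t|]; first by apply/f_cont/pt_ball/clamp_le0.
apply: ccontD; first exact: ccont_cst.
by apply: ccontM; [exact: ccont_cst|exact: ccont_circB].
Qed.

Let kap (t : R) : C := 'i%C * cauchy_kernel t.

Let ccont_kap : ccont kap.
Proof. by apply: ccontM; [exact: ccont_cst|exact: ccont_kernel]. Qed.

Let K : R := r / (r - cabs a).

Let K0 : 0 < K. Proof. by rewrite divr_gt0 // subr_gt0. Qed.

Let cabs_kap t : cabs (kap t) <= K.
Proof.
rewrite cabsM (_ : cabs 'i%C = 1) ?mul1r ?cabs_kernel_le //.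
by rewrite /cabs /= expr0n expr1n add0r sqrtr1.
Qed.

(* The integral of [v (dx + kap dy)] along the boundary of a rectangle. *)
Let I (v : R -> R -> C) (x1 x2 y1 y2 : R) : C :=
  cint x1 x2 (fun x => v x y1 - v x y2) +
  cint y1 y2 (fun y => kap y * (v x2 y - v x1 y)).

(** The two contributions of the common side x = x2 cancel. *)
Let I_catx x1 x2 x3 y1 y2 : x1 <= x2 -> x2 <= x3 -> y1 <= y2 ->
  I u x1 x3 y1 y2 = I u x1 x2 y1 y2 + I u x2 x3 y1 y2.
Proof.
move=> h1 h2 h3; rewrite /I (cint_cat _ h1 h2); last by apply: ccontB.
rewrite addrACA; congr (_ + _).
rewrite -cintD; first last.
- by apply: ccontM => //; apply: ccontB.
- by apply: ccontM => //; apply: ccontB.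
by apply: eq_cint => t _; ring.
Qed.

Let I_caty x1 x2 y1 y2 y3 : x1 <= x2 -> y1 <= y2 -> y2 <= y3 ->
  I u x1 x2 y1 y3 = I u x1 x2 y1 y2 + I u x1 x2 y2 y3.
Proof.
move=> h1 h2 h3; rewrite /I (cint_cat _ h2 h3); last first.
  by apply: ccontM => //; apply: ccontB.
rewrite addrACA; congr (_ + _).
rewrite -cintD; [|by apply: ccontB..].
by apply: eq_cint => t _; ring.
Qed.

(* [dx + kap dy] and [(z - a) (dx + kap dy) = dz] are exact, so affine functions
   of [z] do not contribute to [I]. *)
Let I_affine_le (A B : C) (eta : R) x1 x2 y1 y2 : x1 <= x2 -> x2 <= 0 -> y1 <= y2 ->
  (forall x y, x1 <= x <= x2 -> y1 <= y <= y2 -> cabs (u x y - (A + B * pt x y)) <= eta) ->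
  cabs (I u x1 x2 y1 y2) <= 4 * eta * (1 + K) * ((x2 - x1) + (y2 - y1)).
Proof.
move=> x12 x20 y12 H.
pose E x y := u x y - (A + B * pt x y).
have cpx y : ccont (fun x => pt x y).
  apply: ccontD; first exact: ccont_cst.
  apply: ccontM; last exact: ccont_cst.
  by apply: ccont_real => x; exact: continuous_expR.
have cpy x : ccont (fun y => pt x y).
  apply: ccontD; first exact: ccont_cst.
  by apply: ccontM; [exact: ccont_cst|exact: ccont_circB].
have cEx y : ccont (fun x => E x y).
  apply: ccontB => //; apply: ccontD; first exact: ccont_cst.
  by apply: ccontM => //; exact: ccont_cst.
have cEy x : ccont (fun y => E x y).
  apply: ccontB => //; apply: ccontD; first exact: ccont_cst.
  by apply: ccontM => //; exact: ccont_cst.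
have eta0 : 0 <= eta.
  by apply: le_trans (H x1 y1 _ _); rewrite ?cabs_ge0 ?lexx ?x12 ?y12.
have cI : ccont (fun y => 'i%C * circ y).
  by apply: ccontM; [exact: ccont_cst|exact: ccont_circ].
have cexp : ccont (fun x : R => (expR x)%:C%C).
  by apply: ccont_real => x; exact: continuous_expR.
have dexp : is_cderive (fun x : R => (expR x)%:C%C) (fun x => (expR x)%:C%C).
  by move=> x; split => /=; apply: is_derive_eq.
(* The difference has the integrands B (circ y1 - circ y2) e^x and B (e^x2 - e^x1) 'i circ y. Both
   have explicit primitives, and the two results cancel. *)
have -> : I u x1 x2 y1 y2 = I E x1 x2 y1 y2.
  apply/eqP; rewrite -subr_eq0; apply/eqP; rewrite /I opprD addrACA.
  rewrite -!cintB; try by (apply: ccontM => //; apply: ccontB) || by apply: ccontB.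
  rewrite (eq_cint (psi := fun x => (B * (circ y1 - circ y2)) * (expR x)%:C%C)); last first.
    by move=> x _; rewrite /E /pt; ring.
  rewrite [X in _ + X](eq_cint
    (psi := fun y => (B * (expR x2 - expR x1)%:C%C) * ('i%C * circ y))); last first.
    move=> y _; rewrite /E /pt /kap /cauchy_kernel rmorphB /=.
    by field; exact: circB_neq0.
  rewrite (cintZ _ _ _ cexp) (cintZ _ _ _ cI).
  rewrite (cint_FTC x12 cexp dexp) (cint_FTC y12 cI is_cderive_circB).
  by rewrite rmorphB /=; ring.
apply: le_trans (ler_cabsD _ _) _.
have b1 : cabs (cint x1 x2 (fun x => E x y1 - E x y2)) <= 2 * (2 * eta) * (x2 - x1).
  apply: cabs_cint_le => //; first by apply: ccontB.
  move=> x xx; apply: le_trans (ler_cabsD _ _) _; rewrite cabsN.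
  by rewrite mulr_natl mulr2n lerD // H // ?lexx ?y12.
have b2 : cabs (cint y1 y2 (fun y => kap y * (E x2 y - E x1 y))) <=
    2 * (K * (2 * eta)) * (y2 - y1).
  apply: cabs_cint_le => //; first by apply: ccontM => //; apply: ccontB.
  move=> y yy; rewrite cabsM ler_pM ?cabs_ge0 //.
  apply: le_trans (ler_cabsD _ _) _; rewrite cabsN.
  by rewrite mulr_natl mulr2n lerD // H // ?lexx ?x12.
apply: le_trans (lerD b1 b2) _.
have p1 : 0 <= eta * K by rewrite mulr_ge0 // ltW.
have p2 : 0 <= eta * (y2 - y1) by rewrite mulr_ge0 // subr_ge0.
have p3 : 0 <= eta * K * (x2 - x1) by rewrite mulr_ge0 // subr_ge0.
by nra.
Qed.

(** Goursat's argument: near z0 the function f is affine up to eps |z - z0|. On a rectangle of size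
    s this error is at most a multiple of eps s, so [I_affine_le] bounds the integral by a multiple
    of eps s ^ 2, as the bisection requires. *)
Let I_eq0 X : X <= 0 -> I u X 0 0 (2 * pi) = 0.
Proof.
move=> X0; have pi0 : 0 <= 2 * pi :> R by rewrite mulr_ge0 ?pi_ge0.
apply: (bisection_eq0 I_catx I_caty) => // px py /andP[p1 p2] /andP[p3 p4] e e0.
have [D dD] := f_diff (pt_ball py p2).
have K1 : 0 < 1 + K by rewrite addr_gt0.
(* This is the Lipschitz constant 2 r of [pt] times the constant 4 (1 + K) of [I_affine_le]. *)
have L0 : 0 < 8 * r * (1 + K) by rewrite !mulr_gt0.
have [d d0 dP] := dD (e / (8 * r * (1 + K))) (divr_gt0 e0 L0).
exists (d / (2 * r)); first by rewrite divr_gt0 // mulr_gt0.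
move=> x1 x2 y1 y2 /andP[h1 h2] /andP[h3 h4] /andP[h5 h6] /andP[h7 h8].
set s := (x2 - x1) + (y2 - y1) => sd.
pose z0 := pt px py.
have := @I_affine_le (f z0 - D * z0) D (e / (8 * r * (1 + K)) * (2 * r * s)) x1 x2 y1 y2.
rewrite -/s => /(_ (le_trans h2 h3) h4 (le_trans h6 h7)) H.
apply: le_trans (H _) _; last first.
  rewrite le_eqVlt; apply/orP; left; apply/eqP; field.
  by rewrite !gt_eqF.
move=> x y /andP[k1 k2] /andP[k3 k4]; rewrite /u clampE; last by lra.
have -> : f (pt x y) - (f z0 - D * z0 + D * pt x y) =
  f (pt x y) - f z0 - D * (pt x y - z0) by ring.
have lip : cabs (pt x y - z0) <= 2 * r * s.
  apply: le_trans (pt_lipschitz _ _ _ p2) _; first by lra.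
  rewrite ler_pM2l ?mulr_gt0 // /s lerD //; rewrite ler_norml; lra.
apply: le_trans (dP _ _) _.
  by apply: le_lt_trans lip _; rewrite mulrC -ltr_pdivlMr // mulr_gt0.
by rewrite ler_pM2l ?divr_gt0.
Qed.

(** On [X, 0] x [0, 2 pi] the sides t = 0 and t = 2 pi cancel by periodicity, so the integral of kap
    t * u x t is the same at x = X and at x = 0. As X -> -oo the values of u tend to f a. The
    integral of the kernel itself is evaluated in [cint_cauchy_kernel]. *)
Lemma cauchy_formula :
  cint 0 (2 * pi) (fun t => cauchy_kernel t * f (circ t)) =
  f a * cint 0 (2 * pi) cauchy_kernel.
Proof.
have pi0 : 0 <= 2 * pi :> R by rewrite mulr_ge0 ?pi_ge0.
have u0 t : u 0 t = f (circ t).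
  by rewrite /u clampE // /pt expR0 mul1r subrKC.
have step X : X <= 0 -> cint 0 (2 * pi) (fun t => kap t * (u 0 t - u X t)) = 0.
  move=> X0; rewrite -[RHS](I_eq0 X0) /I.
  (* The vanishing integrand is written 0 * 0 so that [cintZ] can pull out a zero factor. *)
  rewrite (eq_cint (phi := fun x => u x 0 - _) (psi := fun x => 0 * 0)); last first.
    by move=> x _; rewrite /u /pt circ_periodic subrr mulr0.
  by rewrite cintZ ?mul0r ?add0r //; exact: ccont_cst.
have cv v : ccont (fun t => kap t * (u v t - f a)).
  by apply: ccontM => //; apply: ccontB => //; exact: ccont_cst.
have lim0 : cint 0 (2 * pi) (fun t => kap t * (u 0 t - f a)) = 0.
  apply/eqP; rewrite -cabs_eq0 eq_le cabs_ge0 andbT; apply/ler_addgt0Pr => e e0.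
  rewrite add0r.
  have pip : 0 < pi :> R by exact: pi_gt0.
  (* Over a length 2 pi and with |kap| <= K, [cabs_cint_le] turns the bound e / (4 K pi) on u - f a
     into e. *)
  have L0 : 0 < 4 * K * pi by apply: mulr_gt0 => //; apply: mulr_gt0.
  have arho : cabs a < rho by exact: lt_trans ar r_rho.
  have [d d0 dP] := f_cont arho (divr_gt0 e0 L0).
  (* With this X, e^(-X) >= 1 + 2 r / d > 2 r / d, hence 2 r e^X < d, while |circ t - a| <= 2 r. *)
  pose X : R := - (2 * r / d).
  have X0 : X <= 0 by rewrite oppr_le0 divr_ge0 ?mulr_ge0 // ltW.
  have -> : cint 0 (2 * pi) (fun t => kap t * (u 0 t - f a)) =
      cint 0 (2 * pi) (fun t => kap t * (u X t - f a)).
    apply/eqP; rewrite -subr_eq0 -cintB //; apply/eqP; rewrite -[RHS](step X X0).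
    by apply: eq_cint => t _; ring.
  have fld (k p : R) : 0 < k -> 0 < p -> e = 2 * (k * (e / (4 * k * p))) * (2 * p - 0).
    by move=> k0 p0; field; rewrite !gt_eqF.
  rewrite [X in _ <= X](fld K pi K0 pip).
  apply: cabs_cint_le => // t _; rewrite cabsM ler_pM ?cabs_ge0 //.
  apply/ltW/dP; rewrite clampE // /pt addrC addKr cabsM cabs_real.
  rewrite gtr0_norm ?expR_gt0 //.
  have c2 : cabs (circ t - a) <= 2 * r.
    apply: le_trans (ler_cabsD _ _) _; rewrite cabs_circ cabsN.
    by rewrite mulr_natl mulr2n lerD2l ltW.
  apply: le_lt_trans (_ : expR X * (2 * r) < d).
    by rewrite ler_pM2l ?expR_gt0.
  rewrite -ltr_pdivlMr ?mulr_gt0 // -[d / _]invf_div /X expRN.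
  rewrite ltf_pV2 ?posrE ?expR_gt0 ?divr_gt0 ?mulr_gt0 //.
  have := expR_ge1Dx (2 * r / d); lra.
(* As kap = 'i * cauchy_kernel, multiplication by - 'i recovers the kernel. *)
have -> : cint 0 (2 * pi) (fun t => cauchy_kernel t * f (circ t)) =
    cint 0 (2 * pi) (fun t => f a * cauchy_kernel t + (- 'i%C) * (kap t * (u 0 t - f a))).
  apply: eq_cint => t _; rewrite u0 /kap.
  have H (i x y z : C) : i * i = -1 -> x * y = z * x + - i * (i * x * (y - z)).
    move=> i2; have -> : - i * (i * x * (y - z)) = - (i * i) * (x * (y - z)) by ring.
    by rewrite i2; ring.
  by apply: H; rewrite -expr2 sqr_i.
have ck := ccont_kernel.
rewrite cintD; [|by apply: ccontM => //; exact: ccont_cst..].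
by rewrite !cintZ // lim0 mulr0 addr0.
Qed.

End CauchyCircle.

(** * Taylor expansions *)

Section Taylor.
Context {R : realType}.
Notation C := R[i].
Notation Re := (@complex.Re R).
Notation Im := (@complex.Im R).

(** Since q ^ n * 2 ^ n <= 1 and n <= 2 ^ n, a positive x would satisfy n x <= B for every n. The
    ratio 1 / 2 is the reason for the restriction |a| <= r / 2 below. *)
Lemma le0_geometric (x B q : R) : 0 <= q <= 1 / 2 ->
  (forall n, x <= B * q ^+ n) -> x <= 0.
Proof.
move=> /andP[q0 q2] H; rewrite leNgt; apply/negP => x0.
have B0 : 0 < B by apply: lt_le_trans x0 _; have := H 0%N; rewrite expr0 mulr1.
pose n := Num.bound (B / x).
have : B / x < n%:R by apply: archi_boundP; rewrite divr_ge0 // ltW.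
rewrite ltr_pdivrMr // => Bn.
have n2 : n%:R <= 2 ^+ n :> R by rewrite -natrX ler_nat ltnW // ltn_expl.
have q2n : (q ^+ n) * 2 ^+ n <= 1.
  by rewrite -exprMn exprn_ile1 // ?mulr_ge0 //; lra.
have p2 : 0 < 2 ^+ n :> R by rewrite exprn_gt0.
have := H n; rewrite -(ler_pM2r p2) -mulrA => h.
have : x * 2 ^+ n <= B.
  by apply: le_trans h _; rewrite ler_piMr // ltW.
have : n%:R * x <= 2 ^+ n * x by rewrite ler_pM2r.
rewrite [2 ^+ n * x]mulrC; lra.
Qed.

Lemma ccont_bounded (phi : R -> C) (a b : R) : a <= b -> ccont phi ->
  exists M, forall t, a <= t <= b -> cabs (phi t) <= M.
Proof.
move=> ab [c1 c2].
have [|s _ sP] := @EVT_max R (fun t => `|Re (phi t)| + `|Im (phi t)|) a b ab.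
  by apply: continuous_subspaceT => t; apply: cvgD; apply: cvg_norm; [exact: c1|exact: c2].
exists (`|Re (phi s)| + `|Im (phi s)|) => t tab.
by apply: le_trans (cabs_le_ReIm _) _; apply: sP; rewrite in_itv.
Qed.

(** The primitive is periodic, so - 'i k times the integral is 1 - 1. *)
Lemma cint_expi_eq0 (k : nat) : (0 < k)%N ->
  cint 0 (2 * pi) (fun t => expi (- k%:R * t)) = 0 :> C.
Proof.
move=> k0; have pi0 : 0 <= 2 * pi :> R by rewrite mulr_ge0 ?pi_ge0.
have ce := ccont_expi (- k%:R : R).
have := cint_FTC pi0 _ (is_cderive_expi (- k%:R)).
rewrite mulr0 expi0 (cintZ _ _ _ ce).
have -> : expi (- k%:R * (2 * pi)) = 1 :> C.
  have := expiD (- k%:R * (2 * pi) : R) (k%:R * (2 * pi)).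
  by rewrite -mulrDl addNr mul0r expi0 expi_nat expi_2pi expr1n mulr1.
rewrite subrr => /(_ _)/eqP; rewrite mulf_eq0 => H.
have /orP[|/eqP //] := H (ccontM (ccont_cst _) ce).
rewrite mulf_eq0 rmorphN oppr_eq0 fmorph_eq0 pnatr_eq0 eqn0Ngt k0 orbF.
by rewrite eq_complex /= oner_eq0 andbF.
Qed.

Section Coefficients.
Variables (r : R) (phi : R -> C).
Hypotheses (r0 : 0 < r) (phi_cont : ccont phi).

(** With z = circ r t and dz = 'i z dt, this is 2 pi times Cauchy's integral for the k-th Taylor
    coefficient. *)
Definition circ_coef (k : nat) : C :=
  cint 0 (2 * pi) (fun t => (circ r t)^-1 ^+ k * phi t).

Let circ0 t : circ r t != 0.
Proof. by apply: (@circ_neq0 _ _ 0); rewrite cabs0. Qed.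

Let ccontVX n : ccont (fun t => (circ r t)^-1 ^+ n).
Proof. by apply: ccontX; apply: ccontV => //; exact: ccont_circ. Qed.

(** Iterating z / (z - a) = 1 + (a / z) (z / (z - a)) gives a finite geometric sum with exact
    remainder a ^ n * T n. For |a| <= r / 2 the kernel is at most 2 in modulus, and 2 * 2 M * 2 pi =
    8 pi M. *)
Lemma cauchy_integral_expansion M a n : cabs a <= r / 2 ->
  (forall t, 0 <= t <= 2 * pi -> cabs (phi t) <= M) ->
  cabs (cint 0 (2 * pi) (fun t => cauchy_kernel r a t * phi t) -
        \sum_(k < n) circ_coef k * a ^+ k) <= 8 * pi * M * (cabs a / r) ^+ n.
Proof.
move=> ar2 HM.
have ar : cabs a < r by apply: le_lt_trans ar2 _; rewrite ltr_pdivrMr ?ltr_pMr ?ltr1n.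
have ck := ccont_kernel ar.
pose T m := cint 0 (2 * pi)
  (fun t => (circ r t)^-1 ^+ m * (cauchy_kernel r a t * phi t)).
have cT m : ccont (fun t => (circ r t)^-1 ^+ m * (cauchy_kernel r a t * phi t)).
  by apply: ccontM => //; apply: ccontM.
have TS m : T m = circ_coef m + a * T m.+1.
  rewrite /T -cintZ // -cintD; last 2 first.
  - exact: ccontM.
  - by apply: ccontM => //; exact: ccont_cst.
  apply: eq_cint => t _; rewrite /cauchy_kernel exprSr.
  have h1 := circ0 t; have h2 := circB_neq0 ar t.
  have key (x z p : C) : x != 0 -> x - a != 0 ->
    z * (x / (x - a) * p) = z * p + a * (z * x^-1 * (x / (x - a) * p)).
    by move=> x0 xa; field; rewrite x0 xa.
  exact: key.
have -> : cint 0 (2 * pi) (fun t => cauchy_kernel r a t * phi t) -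
    \sum_(k < n) circ_coef k * a ^+ k = a ^+ n * T n.
  elim: n => [|n IH].
    rewrite big_ord0 subr0 expr0 mul1r; apply: eq_cint => t _.
    by rewrite expr0 mul1r.
  by rewrite big_ord_recr /= opprD addrA IH (TS n) exprSr; ring.
have pi0 : 0 <= 2 * pi :> R by rewrite mulr_ge0 ?pi_ge0.
have T_le : cabs (T n) <= 2 * (r^-1 ^+ n * (2 * M)) * (2 * pi - 0).
  apply: cabs_cint_le => // t t2; rewrite cabsM cabsX cabsV (cabs_circ ar).
  rewrite ler_pM2l ?exprn_gt0 ?invr_gt0 // cabsM ler_pM ?cabs_ge0 ?HM //.
  apply: le_trans (cabs_kernel_le ar t) _.
  by rewrite ler_pdivrMr ?subr_gt0 //; lra.
rewrite cabsM cabsX.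
apply: le_trans (ler_wpM2l _ T_le) _; first by rewrite exprn_ge0 ?cabs_ge0.
by rewrite le_eqVlt; apply/orP; left; apply/eqP; rewrite exprMn; ring.
Qed.

End Coefficients.

(** In the expansion for the constant function 1 only the coefficient of index 0 survives, and the
    remainders tend to 0 geometrically. *)
Lemma cint_cauchy_kernel (r : R) a : 0 < r -> cabs a <= r / 2 ->
  cint 0 (2 * pi) (cauchy_kernel r a) = (2 * pi)%:C%C.
Proof.
move=> r0 ar2.
have pi0 : 0 <= 2 * pi :> R by rewrite mulr_ge0 ?pi_ge0.
have c1 : ccont (fun _ : R => 1 : C) by exact: ccont_cst.
have coef k : circ_coef r (fun=> 1) k = if k is 0%N then (2 * pi)%:C%C else 0.
  case: k => [|k].
    rewrite /circ_coef.
    have d1 : is_cderive (fun t : R => t%:C%C) (fun _ => 1).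
      by move=> t; split=> /=; [exact: is_derive_id|exact: is_derive_cst].
    transitivity (cint 0 (2 * pi) (fun _ : R => 1 : C)).
      by apply: eq_cint => t _; rewrite expr0 mulr1.
    by rewrite (cint_FTC pi0 c1 d1) subr0.
  transitivity (cint 0 (2 * pi) (fun t : R => (r%:C%C : C)^-1 ^+ k.+1 * expi (- k.+1%:R * t))); last first.
    by rewrite cintZ ?cint_expi_eq0 ?mulr0 //; exact: ccont_expi.
  apply: eq_cint => t _; rewrite mulr1 /circ invfM exprMn; congr (_ * _).
  have := expiD (- k.+1%:R * t : R) (k.+1%:R * t).
  rewrite -mulrDl addNr mul0r expi0 expi_nat => e.
  apply: (mulIf (expf_neq0 k.+1 (expi_neq0 t))).
  by rewrite -e -exprMn mulVf ?expi_neq0 // expr1n.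
apply/eqP; rewrite -subr_eq0 -cabs_eq0 eq_le cabs_ge0 andbT.
(* The expansion is taken with n + 1 terms, so that the term of index 0 is always present; the extra
   factor |a| / r <= 1 / 2 goes into the constant. *)
apply: (@le0_geometric _ (8 * pi * 1 / 2) (cabs a / r)).
  by rewrite divr_ge0 ?cabs_ge0 ?(ltW r0) // ler_pdivrMr //; lra.
move=> n.
have := @cauchy_integral_expansion r (fun=> 1) r0 c1 1 a n.+1 ar2.
rewrite (big_ord_recl n) coef big1 ?addr0; last by move=> i _; rewrite coef mul0r.
rewrite expr0 mulr1 (eq_cint (psi := cauchy_kernel r a)); last first.
  by move=> t _; rewrite mulr1.
move=> /(_ _) h; apply: le_trans (h _) _; first by rewrite cabs1.
have q0 : 0 <= cabs a / r by rewrite divr_ge0 ?cabs_ge0 // ltW.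
have q2 : cabs a / r <= 1 / 2 by rewrite ler_pdivrMr //; lra.
have p1 : 0 <= (cabs a / r) ^+ n by rewrite exprn_ge0.
have p2 : 0 <= pi * (cabs a / r) ^+ n by rewrite mulr_ge0 ?pi_ge0.
by rewrite exprS; nra.
Qed.

(** Cauchy's formula on a circle inside the domain feeds [cauchy_integral_expansion]. A single M
    serves all n, which is what lets vanishing coefficients force a vanishing germ. *)
Lemma holomorphic_taylor (f : C -> C) (rho : R) : 0 < rho ->
  (forall z, cabs z < rho -> exists D, is_cdiff f z D) ->
  exists r M (c : nat -> C), [/\ 0 < r, 0 <= M &
    forall n a, cabs a <= r / 2 ->
      cabs (f a - \sum_(k < n) c k * a ^+ k) <= M * (cabs a / r) ^+ n].
Proof.
move=> rho0 df; pose r := rho / 2.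
have r0 : 0 < r by rewrite divr_gt0.
have r_rho : r < rho by rewrite /r; lra.
have pi0 : 0 <= 2 * pi :> R by rewrite mulr_ge0 ?pi_ge0.
have tpi : (2 * pi)%:C%C != 0 :> C.
  by rewrite fmorph_eq0 mulf_neq0 // gt_eqF ?pi_gt0.
pose phi t := f (circ r t).
have cphi : ccont phi.
  apply: ccont_comp => [t|]; last exact: ccont_circ.
  have [|D dD] := df (circ r t); last exact: is_cdiff_cont dD.
  by rewrite (@cabs_circ _ _ 0) // cabs0.
have [M HM] := ccont_bounded pi0 cphi.
have M0 : 0 <= M.
  by apply: le_trans (cabs_ge0 _) (HM 0 _); rewrite lexx pi0.
(* Division by 2 pi turns 8 pi M into 4 M. *)
exists r, (4 * M), (fun k => (2 * pi)%:C%C^-1 * circ_coef r phi k).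
split=> // [|n a ar2]; first by rewrite mulr_ge0.
have ar : cabs a < r by apply: le_lt_trans ar2 _; rewrite ltr_pdivrMr ?ltr_pMr ?ltr1n.
have := cauchy_formula ar r_rho df; rewrite cint_cauchy_kernel // => e.
have := cauchy_integral_expansion r0 cphi n ar2 HM; rewrite e => h.
have -> : f a - \sum_(k < n) (2 * pi)%:C%C^-1 * circ_coef r phi k * a ^+ k =
    (2 * pi)%:C%C^-1 * (f a * (2 * pi)%:C%C - \sum_(k < n) circ_coef r phi k * a ^+ k).
  rewrite mulrBr mulrCA mulVf // mulr1 mulr_sumr; congr (_ - _).
  by apply: eq_bigr => i _; rewrite mulrA.
rewrite cabsM cabsV cabs_real ger0_norm // mulrC ler_pdivrMr.
  by apply: le_trans h _; rewrite le_eqVlt; apply/orP; left; apply/eqP; ring.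
by rewrite mulr_gt0 ?pi_gt0.
Qed.

End Taylor.

(** * Leading terms of germs at 0 *)

Section Leading.
Context {R : realType}.
Notation C := R[i].
Implicit Types (f g phi psi : C -> C) (l k z : C) (n m : nat).

(** Neighbourhoods of 0 with real radii; [near0P] identifies them with those of the filter. *)
Definition near0 (P : C -> Prop) := exists2 d : R, 0 < d & forall z, cabs z < d -> P z.

Lemma near0_and P Q : near0 P -> near0 Q -> near0 (fun z => P z /\ Q z).
Proof.
move=> [d d0 dP] [e e0 eP]; exists (Num.min d e); first by rewrite lt_min d0 e0.
by move=> z; rewrite lt_min => /andP[/dP ? /eP].
Qed.

Lemma near0_sub P Q : (forall z, P z -> Q z) -> near0 P -> near0 Q.
Proof. by move=> PQ [d d0 dP]; exists d => // z /dP /PQ. Qed.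

Lemma near0_lt (e : R) : 0 < e -> near0 (fun z => cabs z < e).
Proof. by exists e. Qed.

(* [phi z = l z ^ n + o(z ^ n)] at 0; [l = 0] is allowed. *)
Definition leading phi n l :=
  forall e : R, 0 < e -> near0 (fun z => cabs (phi z - l * z ^+ n) <= e * cabs z ^+ n).

Lemma leading_eq phi psi n l : near0 (fun z => phi z = psi z) ->
  leading phi n l -> leading psi n l.
Proof.
move=> h H e e0; apply: near0_sub (near0_and h (H e e0)) => z [<-]; exact.
Qed.

Lemma leading_le phi n l : leading phi n l ->
  near0 (fun z => cabs (phi z) <= (cabs l + 1) * cabs z ^+ n).
Proof.
move=> H; apply: near0_sub (H 1 ltr01) => z h.
rewrite -[phi z](subrK (l * z ^+ n)); apply: le_trans (ler_cabsD _ _) _.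
by rewrite cabsM cabsX mulrDl addrC lerD2l.
Qed.

Lemma leadingD phi psi n l k : leading phi n l -> leading psi n k ->
  leading (fun z => phi z + psi z) n (l + k).
Proof.
move=> H1 H2 e e0; have e20 : 0 < e / 2 by rewrite divr_gt0.
apply: near0_sub (near0_and (H1 _ e20) (H2 _ e20)) => z [h1 h2].
have -> : phi z + psi z - (l + k) * z ^+ n =
  (phi z - l * z ^+ n) + (psi z - k * z ^+ n) by ring.
by apply: le_trans (ler_cabsD _ _) _; rewrite [e in leRHS]splitr mulrDl lerD.
Qed.

Lemma leadingX n : leading (fun z => z ^+ n) n 1.
Proof.
move=> e e0; exists 1 => // z _.
by rewrite mul1r subrr cabs0 mulr_ge0 ?exprn_ge0 ?cabs_ge0 // ltW.
Qed.

Lemma leadingM phi psi n m l k : leading phi n l -> leading psi m k ->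
  leading (fun z => phi z * psi z) (n + m) (l * k).
Proof.
(* K dominates both |l| and |k| + 1, so each of the two error terms of the product is at most half
   of the allowed error. *)
move=> H1 H2 e e0; pose K := cabs l + cabs k + 1.
have K0 : 0 < K by rewrite ltr_wpDl // addr_ge0 ?cabs_ge0.
have eK : 0 < e / (2 * K) by rewrite divr_gt0 // mulr_gt0.
apply: near0_sub (near0_and (H1 _ eK) (near0_and (H2 _ eK) (leading_le H2))).
move=> z [h1 [h2 h3]].
have -> : phi z * psi z - l * k * z ^+ (n + m) =
    (phi z - l * z ^+ n) * psi z + l * z ^+ n * (psi z - k * z ^+ m).
  by rewrite exprD; ring.
apply: le_trans (ler_cabsD _ _) _; rewrite !cabsM cabsX.
have p1 : 0 <= cabs z ^+ n by rewrite exprn_ge0 ?cabs_ge0.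
have p2 : 0 <= cabs z ^+ m by rewrite exprn_ge0 ?cabs_ge0.
have b1 : cabs (phi z - l * z ^+ n) * cabs (psi z) <=
    (e / (2 * K) * cabs z ^+ n) * (K * cabs z ^+ m).
  rewrite ler_pM ?cabs_ge0 //; apply: le_trans h3 _; rewrite ler_wpM2r //.
  by rewrite lerD2r lerDr cabs_ge0.
have b2 : cabs l * cabs z ^+ n * cabs (psi z - k * z ^+ m) <=
    (K * cabs z ^+ n) * (e / (2 * K) * cabs z ^+ m).
  rewrite ler_pM ?mulr_ge0 ?cabs_ge0 //; rewrite ler_wpM2r //.
  by rewrite /K -addrA lerDl addr_ge0 ?cabs_ge0.
apply: le_trans (lerD b1 b2) _; rewrite exprD le_eqVlt; apply/orP; left; apply/eqP.
by field; rewrite gt_eqF.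
Qed.

Lemma leading_cst k : leading (fun=> k) 0 k.
Proof. by move=> e e0; exists 1 => // z _; rewrite expr0 !mulr1 subrr cabs0 ltW. Qed.

Lemma leadingZ phi n l k : leading phi n l -> leading (fun z => k * phi z) n (k * l).
Proof. by move=> h; apply: (leadingM (leading_cst k) h). Qed.

Lemma leadingN phi n l : leading phi n l -> leading (fun z => - phi z) n (- l).
Proof.
move=> /(leadingZ (-1)); rewrite mulN1r; apply: leading_eq.
by exists 1 => // z _; rewrite mulN1r.
Qed.

Lemma leading0 n : leading (fun=> 0) n 0.
Proof.
move=> e e0; exists 1 => // z _.
by rewrite mul0r subrr cabs0 mulr_ge0 ?exprn_ge0 ?cabs_ge0 // ltW.
Qed.

Lemma leading_sum N (phi : 'I_N -> C -> C) n (l : 'I_N -> C) :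
  (forall i, leading (phi i) n (l i)) ->
  leading (fun z => \sum_(i < N) phi i z) n (\sum_(i < N) l i).
Proof.
elim: N phi l => [|N IH] phi l H.
  rewrite big_ord0; apply: leading_eq (leading0 n).
  by exists 1 => // z _; rewrite big_ord0.
rewrite big_ord_recr /=.
apply: leading_eq (leadingD (IH _ _ (fun i => H (widen_ord (leqnSn N) i))) (H ord_max)).
by exists 1 => // z _; rewrite big_ord_recr.
Qed.

Lemma leading_exp phi n l m : leading phi n l -> leading (fun z => phi z ^+ m) (m * n) (l ^+ m).
Proof.
move=> H; elim: m => [|m IH]; first by apply: leading_eq (leading_cst 1); exists 1.
rewrite mulSn exprS; apply: leading_eq (leadingM H IH).
by exists 1 => // z _; rewrite exprS.
Qed.

Lemma leading_succ phi n l : leading phi n.+1 l -> leading phi n 0.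
Proof.
move=> H e e0.
have K0 : 0 < cabs l + 1 by rewrite ltr_wpDl ?cabs_ge0.
apply: near0_sub (near0_and (leading_le H) (near0_lt (divr_gt0 e0 K0))) => z [h1 h2].
rewrite mul0r subr0; apply: le_trans h1 _; rewrite exprS mulrA ler_wpM2r //.
  by rewrite exprn_ge0 ?cabs_ge0.
by rewrite mulrC -ler_pdivlMr // ltW.
Qed.

Lemma leading_lower phi n m l : (n < m)%N -> leading phi m l -> leading phi n 0.
Proof.
move=> /subnKC <-; move: (m - _)%N => k; elim: k l => [|k IH] l.
  by rewrite addn0; exact: leading_succ.
by rewrite addnS => /leading_succ; exact: IH.
Qed.

(** The zero function phi - phi has leading coefficient l - k; testing it at the nonzero real point
    d / 2 gives |l - k| <= e for every e > 0. *)
Lemma leading_uniq phi n l k : leading phi n l -> leading phi n k -> l = k.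
Proof.
move=> H1 /leadingN H2; apply/eqP; rewrite -subr_eq0 -cabs_eq0 eq_le cabs_ge0 andbT.
apply/ler_addgt0Pr => e e0; rewrite add0r.
have [d d0 dP] := leadingD H1 H2 e0.
have d2 : 0 < d / 2 by rewrite divr_gt0.
have := dP (d / 2)%:C%C; rewrite cabs_real gtr0_norm // subrr sub0r cabsN => /(_ _).
rewrite cabsM cabsX cabs_real gtr0_norm // ler_pM2r ?exprn_gt0 //; apply.
by rewrite ltr_pdivrMr // mulr2n mulrDr mulr1 ltrDl.
Qed.

(** Since psi = O(z), an error o(psi ^ n) is o(z ^ n). The bound |k| + 1 in place of |k| covers k =
    0. *)
Lemma leading_comp phi psi n l k : leading phi n l -> leading psi 1 k ->
  leading (fun z => phi (psi z)) n (l * k ^+ n).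
Proof.
move=> H1 H2; have H3 := leading_exp n H2; rewrite muln1 in H3.
apply: leading_eq (_ : leading (fun z => (phi (psi z) - l * psi z ^+ n) + l * psi z ^+ n) _ _).
  by exists 1 => // z _; rewrite subrK.
rewrite -[l * _]add0r; apply: leadingD (leadingZ l H3) => e e0.
have K0 : 0 < cabs k + 1 by rewrite ltr_wpDl ?cabs_ge0.
have Kn0 : 0 < (cabs k + 1) ^+ n by rewrite exprn_gt0.
have [d d0 dP] := H1 _ (divr_gt0 e0 Kn0).
apply: near0_sub (near0_and (leading_le H2) (near0_lt (divr_gt0 d0 K0))) => z [].
rewrite expr1 ltr_pdivlMr // mulrC => h1 h2; rewrite mul0r subr0.
apply: le_trans (dP _ (le_lt_trans h1 h2)) _.
rewrite mulrAC ler_pdivrMr // -mulrA ler_pM2l // -exprMn.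
by rewrite lerXn2r ?nnegrE ?mulr_ge0 ?cabs_ge0 ?(ltW K0) // mulrC.
Qed.

Lemma is_cdiff_leading f l : f 0 = 0 -> is_cdiff f 0 l <-> leading f 1 l.
Proof.
move=> f0; split=> H e /H[d d0 dP]; exists d => // z.
  by have := dP z; rewrite f0 !subr0 expr1.
by have := dP z; rewrite f0 !subr0 expr1.
Qed.

(** * Holomorphic germs fixing 0 and their Taylor coefficients *)

Definition holo0 f := f 0 = 0 /\ near0 (fun z => exists D, is_cdiff f z D).

Lemma is_cdiff_comp f g z D D' : is_cdiff f z D -> is_cdiff g (f z) D' ->
  is_cdiff (g \o f) z (D' * D).
Proof.
move=> df dg e e0.
have K0 : 0 < cabs D + 1 by rewrite ltr_wpDl ?cabs_ge0.
have K0' : 0 < cabs D' + 1 by rewrite ltr_wpDl ?cabs_ge0.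
have e1 : 0 < e / (2 * (cabs D + 1)) by rewrite divr_gt0 // mulr_gt0.
have e2 : 0 < e / (2 * (cabs D' + 1)) by rewrite divr_gt0 // mulr_gt0.
have [d1 d10 P1] := dg _ e1; have [d2 d20 P2] := df _ e2; have [d3 d30 P3] := df _ ltr01.
exists (Num.min (Num.min d2 d3) (d1 / (cabs D + 1))).
  by rewrite !lt_min d20 d30 divr_gt0.
move=> w; rewrite !lt_min => /andP[/andP[/P2 h2 /P3 h3]]; rewrite ltr_pdivlMr // => h1.
have fw : cabs (f w - f z) <= (cabs D + 1) * cabs (w - z).
  rewrite -[f w - f z](subrK (D * (w - z))); apply: le_trans (ler_cabsD _ _) _.
  by rewrite cabsM mulrDl addrC lerD2l.
have h4 : cabs (g (f w) - g (f z) - D' * (f w - f z)) <= e / 2 * cabs (w - z).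
  apply: le_trans (P1 _ _) _; first by apply: le_lt_trans fw _; rewrite mulrC.
  apply: le_trans (ler_wpM2l (ltW e1) fw) _.
  by rewrite le_eqVlt; apply/orP; left; apply/eqP; field; rewrite gt_eqF.
have h5 : cabs (D' * (f w - f z - D * (w - z))) <= e / 2 * cabs (w - z).
  rewrite cabsM; apply: le_trans (_ : (cabs D' + 1) * (e / (2 * (cabs D' + 1)) * cabs (w - z)) <= _).
    by rewrite ler_pM ?cabs_ge0 // lerDl.
  by rewrite le_eqVlt; apply/orP; left; apply/eqP; field; rewrite gt_eqF.
have -> : (g \o f) w - (g \o f) z - D' * D * (w - z) =
  (g (f w) - g (f z) - D' * (f w - f z)) + D' * (f w - f z - D * (w - z)).
  by rewrite /=; ring.
by apply: le_trans (ler_cabsD _ _) _; rewrite [e in leRHS]splitr mulrDl lerD.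
Qed.

Lemma is_cdiffB f g z D D' : is_cdiff f z D -> is_cdiff g z D' ->
  is_cdiff (fun w => f w - g w) z (D - D').
Proof.
move=> df dg e e0; have e20 : 0 < e / 2 by rewrite divr_gt0.
have [d1 d10 P1] := df _ e20; have [d2 d20 P2] := dg _ e20.
exists (Num.min d1 d2); first by rewrite lt_min d10.
move=> w; rewrite lt_min => /andP[/P1 h1 /P2 h2].
have -> : f w - g w - (f z - g z) - (D - D') * (w - z) =
  (f w - f z - D * (w - z)) - (g w - g z - D' * (w - z)) by ring.
apply: le_trans (ler_cabsD _ _) _; rewrite cabsN.
by rewrite [e in leRHS]splitr mulrDl lerD.
Qed.

Lemma is_cdiff_id z : is_cdiff id z 1.
Proof.
move=> e e0; exists 1 => // w _.
by rewrite mul1r subrr cabs0 mulr_ge0 ?cabs_ge0 // ltW.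
Qed.

Lemma near0_comp f P : f 0 = 0 -> ccont_at f 0 -> near0 P -> near0 (fun z => P (f z)).
Proof.
move=> f0 fc [d d0 dP]; have [e e0 eP] := fc d d0; exists e => // z ze; apply: dP.
by have := eP z; rewrite f0 !subr0; exact.
Qed.

Lemma holo0_cont f : holo0 f -> ccont_at f 0.
Proof.
move=> [_ [d d0 dP]]; have [|D] := dP 0; first by rewrite cabs0.
exact: is_cdiff_cont.
Qed.

Lemma holo0_taylor f : holo0 f -> exists c : nat -> C,
  (forall n, leading (fun z => f z - \sum_(k < n) c k * z ^+ k) n (c n)) /\
  ((forall n, c n = 0) -> near0 (fun z => f z = 0)).
Proof.
move=> [_ [rho rho0 fd]]; have [r [M [c [r0 M0 H]]]] := holomorphic_taylor rho0 fd.
have r2 : 0 < r / 2 by rewrite divr_gt0.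
exists c; split=> [n e e0|c0].
  have M1 : 0 < M + 1 by rewrite ltr_wpDl.
  (* The remainder after n + 1 terms is at most M (|z| / r) ^ (n + 1). This radius makes it at most
     e |z| ^ n, and M + 1 allows M = 0. *)
  have d0 : 0 < e * r ^+ n.+1 / (M + 1) by rewrite divr_gt0 // mulr_gt0 // exprn_gt0.
  apply: near0_sub (near0_and (near0_lt r2) (near0_lt d0)) => z [/ltW zr].
  rewrite ltr_pdivlMr // => zd.
  have := H n.+1 z zr; rewrite big_ord_recr /= opprD addrA => h; apply: le_trans h _.
  rewrite expr_div_n mulrA ler_pdivrMr ?exprn_gt0 // exprS mulrA.
  rewrite [leRHS]mulrAC ler_wpM2r ?exprn_ge0 ?cabs_ge0 //.
  apply: le_trans (ltW zd); rewrite mulrC ler_wpM2l ?cabs_ge0 //; lra.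
exists (r / 2) => // z /ltW zr; apply/eqP; rewrite -cabs_eq0 eq_le cabs_ge0 andbT.
apply: (@le0_geometric _ _ M (cabs z / r)) => [|n].
  by rewrite divr_ge0 ?cabs_ge0 ?(ltW r0) // ler_pdivrMr //; lra.
by have := H n z zr; rewrite big1 ?subr0 // => i _; rewrite c0 mul0r.
Qed.

Theorem commuting_tangent_to_id f g l : holo0 f -> holo0 g ->
  is_cdiff f 0 l -> is_cdiff g 0 1 -> l != 0 -> (forall n, (0 < n)%N -> l ^+ n != 1) ->
  near0 (fun z => f (g z) = g (f z)) -> near0 (fun z => g z = z).
Proof.
move=> hf hg fl g1 l0 ln1 fg.
have lf : leading f 1 l by apply/is_cdiff_leading => //; exact: hf.1.
have lg : leading g 1 1 by apply/is_cdiff_leading => //; exact: hg.1.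
pose F z := g z - z.
have hF : holo0 F.
  split; first by rewrite /F hg.1 subrr.
  apply: near0_sub hg.2 => z [D dD]; exists (D - 1).
  by apply: is_cdiffB => //; exact: is_cdiff_id.
have [c [cF c0F]] := holo0_taylor hF.
have [c0|/existsNP[m /eqP cm]] := pselect (forall n, c n = 0).
  by apply: near0_sub (c0F c0) => z /eqP; rewrite subr_eq0 => /eqP.
exfalso; have exc : exists n, c n != 0 by exists m.
case: (ex_minnP exc) => n cn0 nmin {m cm exc}.
have clt (k : nat) : (k < n)%N -> c k = 0.
  by move=> kn; apply/eqP; apply: contraTT kn => /nmin; rewrite -leqNgt.
have lF : leading F n (c n).
  apply: leading_eq (cF n); exists 1 => // z _.
  by rewrite big1 ?subr0 // => i _; rewrite clt ?mul0r.
(* The linear terms of g and the identity cancel, so F = o(z); uniqueness of leading coefficients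
   then excludes n = 0 and n = 1. *)
have LF1 : leading F 1 0.
  have := leadingD lg (leadingN (leadingX 1)); rewrite subrr; apply: leading_eq.
  by exists 1.
have LF0 : leading F 0 0 by exact: leading_succ LF1.
have n2 : (1 < n)%N.
  case: n cn0 lF {nmin clt} => [|[|//]] cn0 lF.
    by move: cn0; rewrite (leading_uniq lF LF0) eqxx.
  by move: cn0; rewrite (leading_uniq lF LF1) eqxx.
(* From g ^ (k + 1) - z ^ (k + 1) = (g ^ k - z ^ k) g + z ^ k F, the order exceeds n as soon as the
   exponent exceeds 1. Only exponent 1 contributes at order n. *)
have gX (k : nat) : leading (fun z => g z ^+ k - z ^+ k) n (if k == 1%N then c n else 0).
  elim: k => [|k IH].
    by apply: leading_eq (leading0 n); exists 1 => // z _; rewrite !expr0 subrr.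
  have [->|k0] := posnP k; first by apply: leading_eq lF; exists 1.
  rewrite eqSS (gtn_eqF k0).
  have T1 : leading (fun z => (g z ^+ k - z ^+ k) * g z) n 0.
    by apply: leading_lower (leadingM IH lg); rewrite addn1.
  have T2 : leading (fun z => z ^+ k * F z) n 0.
    by apply: leading_lower (leadingM (leadingX k) lF); rewrite -{1}[n]add0n ltn_add2r.
  have := leadingD T1 T2; rewrite addr0; apply: leading_eq; exists 1 => // z _.
  by rewrite /F !exprSr; ring.
have [b [bf _]] := holo0_taylor hf.
have b0 : b 0%N = 0.
  apply: (leading_uniq (phi := f)); last exact: leading_succ lf.
  by apply: leading_eq (bf 0%N); exists 1 => // z _; rewrite big_ord0 subr0.
have b1 : b 1%N = l.
  apply: (leading_uniq (phi := f)) lf.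
  by apply: leading_eq (bf 1%N); exists 1 => // z _; rewrite big_ord1 b0 mul0r subr0.
(* Subtracting the terms up to degree n included leaves E = o(z ^ n), and E(g z) is o(z ^ n) as
   well. *)
pose E z := f z - \sum_(k < n.+1) b k * z ^+ k.
have lE : leading E n 0 by exact: leading_succ (bf n.+1).
have lEg : leading (fun z => E (g z)) n 0.
  by have := leading_comp lE lg; rewrite mul0r.
have lP : leading (fun z => \sum_(k < n.+1) b k * (g z ^+ k - z ^+ k)) n (l * c n).
  have := leading_sum (fun k : 'I_n.+1 => leadingZ (b k) (gX k)).
  rewrite (bigD1 (Ordinal (ltnW n2 : 1 < n.+1)%N)) //= b1 big1 ?addr0 // => i ne.
  rewrite ifN ?mulr0 //; apply: contraNN ne => /eqP e; apply/eqP; exact: val_inj.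
have lfg : leading (fun z => f (g z) - f z) n (l * c n).
  have := leadingD (leadingD lP lEg) (leadingN lE); rewrite oppr0 !addr0.
  apply: leading_eq; exists 1 => // z _; rewrite /E.
  have -> : \sum_(k < n.+1) b k * (g z ^+ k - z ^+ k) =
      \sum_(k < n.+1) b k * g z ^+ k - \sum_(k < n.+1) b k * z ^+ k.
    by rewrite -sumrB; apply: eq_bigr => i _; rewrite mulrBr.
  by ring.
(* F(f z) = g(f z) - f z is the other side of the comparison. *)
have lFf := leading_comp lF lf.
have e : l * c n = c n * l ^+ n.
  apply: leading_uniq lfg _; apply: leading_eq lFf.
  by apply: near0_sub fg => z ->.
have /ln1/eqP : (0 < n.-1)%N by case: n n2 {cn0 nmin clt lF gX E lE lEg lP lfg lFf e} => [|[]].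
(* Cancelling c n * l in l * c n = c n * l ^ n leaves l ^ (n - 1) = 1. *)
apply; apply: (mulfI (mulf_neq0 cn0 l0)).
by rewrite mulr1 [RHS]mulrC e -mulrA -exprS prednK // ltnW.
Qed.

End Leading.

(** * Holomorphic germs *)

Section Bridge.
Context {R : realType}.
Notation C := R[i].

(** Radii of balls are elements of R[i]; a positive one has zero imaginary part, so it is a real
    radius. *)
Lemma near_cabsP (P : Cplx R -> Prop) (z0 : Cplx R) :
  (\forall z \near z0, P z) <->
  exists2 d : R, 0 < d & forall z, cabs (z - z0) < d -> P z.
Proof.
split=> [/nbhs_ballP[e /= e0 eP]|[d d0 dP]].
  have eE : e = (complex.Re e)%:C%C.
    by move: e0; rewrite ltcE /= => /andP[/eqP]; case: e {eP} => x y /= ->.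
  exists (complex.Re e) => [|z zd]; first by move: e0; rewrite {1}eE ltcR.
  apply: eP; rewrite -ball_normE /= distrC eE.
  by rewrite [ltLHS](_ : _ = (cabs (z - z0))%:C%C) // ltcR.
apply/nbhs_ballP; exists d%:C%C => /=; first by rewrite ltcR.
move=> z; rewrite -ball_normE /= distrC => h; apply: dP.
by move: h; rewrite [ltLHS](_ : _ = (cabs (z - z0))%:C%C) // ltcR.
Qed.

Lemma near0P (P : Cplx R -> Prop) : (\forall z \near (0 : Cplx R), P z) <-> near0 P.
Proof.
split=> [/near_cabsP[d d0 dP]|[d d0 dP]].
  by exists d => // z; rewrite -[z in cabs z]subr0; exact: dP.
by apply/near_cabsP; exists d => // z; rewrite subr0; exact: dP.
Qed.

Lemma derivable_is_cdiff (f : Cplx R -> Cplx R) (z : Cplx R) :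
  derivable f z 1 -> is_cdiff f z (derive1 f z).
Proof.
move=> df e e0.
have : ((fun h => h^-1 *: (f (h + z) - f z)) @ 0^' --> derive1 f z)%classic.
  rewrite /derive1; move: df; rewrite /derivable.
  have -> : (fun h : Cplx R => h^-1 *: (f (h *: 1 + z) - f z)) =
      (fun h => h^-1 *: (f (h + z) - f z)).
    by apply: funext => h; rewrite [h *: 1]mulr1.
  by [].
move=> /cvgrPdist_le/(_ e%:C%C); rewrite ltcR => /(_ e0).
rewrite /dnbhs /= => /near_cabsP[d d0 dP]; exists d => // w wd.
have [->|wz] := eqVneq w z.
  by rewrite !subrr mulr0 subrr cabs0 mulr0.
have := dP (w - z); rewrite subr0 => /(_ wd); rewrite subr_eq0 => /(_ wz).
rewrite subrK distrC [leLHS](_ : _ =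
  (cabs ((w - z)^-1 * (f w - f z) - derive1 f z))%:C%C) // lecR => h.
have wz0 : w - z != 0 by rewrite subr_eq0.
have -> : f w - f z - derive1 f z * (w - z) =
    ((w - z)^-1 * (f w - f z) - derive1 f z) * (w - z).
  by rewrite mulrBl mulrAC mulVf // mul1r.
by rewrite cabsM ler_wpM2r ?cabs_ge0.
Qed.

Lemma holo_germ_holo0 (f : Cplx R -> Cplx R) : holo_germ f ->
  holo0 f /\ is_cdiff f 0 (derive1 f 0).
Proof.
move=> [f0 /near0P[d d0 df]]; split; last first.
  by apply/derivable_is_cdiff/df; rewrite cabs0.
split=> //; exists d => // z /df /derivable_is_cdiff; by exists (derive1 f z).
Qed.

Lemma holo0_iter (g : C -> C) (D : C) n : holo0 g -> is_cdiff g 0 D ->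
  holo0 (iter n g) /\ is_cdiff (iter n g) 0 (D ^+ n).
Proof.
move=> hg gD; elim: n => [|n [hn nD]].
  split; last by rewrite expr0; exact: is_cdiff_id.
  by split=> //; exists 1 => // z _; exists 1; exact: is_cdiff_id.
split; last by rewrite exprS; apply: (is_cdiff_comp nD); rewrite hn.1.
split; first by rewrite iterS hn.1 hg.1.
apply: near0_sub (near0_and hn.2 (near0_comp hn.1 (holo0_cont hn) hg.2)).
move=> z [[D1 d1] [D2 d2]]; exists (D2 * D1); exact: is_cdiff_comp d1 d2.
Qed.

(** Commutation is known only near 0, so each step also uses continuity of [iter n g] to keep its
    values in that neighbourhood. *)
Lemma iter_commute (f g : C -> C) n : holo0 g ->
  near0 (fun z => f (g z) = g (f z)) ->
  near0 (fun z => f (iter n g z) = iter n g (f z)).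
Proof.
move=> hg; have [D gD] : exists D, is_cdiff g 0 D.
  by have [_ [d d0 dP]] := hg; apply: dP; rewrite cabs0.
move=> fg; elim: n => [|n IH]; first by exists 1.
have [hn _] := holo0_iter n hg gD.
apply: near0_sub (near0_and IH (near0_comp hn.1 (holo0_cont hn) fg)).
by move=> z [h1 h2]; rewrite !iterS h2 h1.
Qed.

(** * Irrational rotations have infinite order *)

Lemma expi_int (k : int) : expi (2 * pi * k%:~R) = 1 :> C.
Proof.
have Hn (n : nat) : expi (2 * pi * n%:R) = 1 :> C.
  by rewrite mulrC expi_nat expi_2pi expr1n.
case: k => n; first exact: Hn.
rewrite NegzE rmorphN /= mulrN -[LHS]mulr1 -{1}(Hn n.+1) -expiD.
by rewrite addrC subrr expi0.
Qed.

(** For the fractional part y of x, cos (2 pi y) = 1 forces sin (pi y) = 0, whereas sin is positive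
    on ]0, pi[. *)
Lemma expi_eq1 (x : R) : expi (2 * pi * x) = 1 :> C -> exists k : int, x = k%:~R.
Proof.
move=> e; exists (Num.floor x); pose y := x - (Num.floor x)%:~R.
have y0 : 0 <= y by rewrite subr_ge0 floor_le_tmp.
have y1 : y < 1 by rewrite ltrBlDl -intrD1 floorD1_gt.
have ey : expi (2 * pi * y) = 1 :> C.
  by rewrite -[LHS]mulr1 -{1}(expi_int (Num.floor x)) -expiD /y -mulrDr subrK.
apply/eqP; rewrite -subr_eq0 -/y; apply/negPn/negP => yn0.
have yp : 0 < y by rewrite lt0r yn0.
have : 0 < sin (pi * y).
  by apply: sin_gt0_pi; rewrite mulr_gt0 ?pi_gt0 //= gtr_pMr ?pi_gt0.
suff -> : sin (pi * y) = 0 by rewrite ltxx.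
have : cos (2 * pi * y) = 1 by case: ey.
rewrite -mulrA mulr_natl cos_mulr2n cos2sin2 => h.
by apply/eqP; rewrite -sqrf_eq0; apply/eqP; lra.
Qed.

Lemma irrational_rotation (alpha : R) n : irrational alpha -> (0 < n)%N ->
  rot_mult alpha ^+ n != 1.
Proof.
move=> irr n0; apply/eqP => e; apply: irr; apply/rationalP.
have [k kE] : exists k : int, n%:R * alpha = k%:~R.
  by apply: expi_eq1; rewrite mulrCA expi_nat.
exists k, n; rewrite -kE [_%:R * _]mulrC mulfK //.
by rewrite pnatr_eq0 -lt0n.
Qed.

End Bridge.

Theorem theorem3p6 (R : realType) (alpha : R) (f g : Cplx R -> Cplx R) :
  irrational alpha ->
  holo_germ f -> derive1 f 0 = rot_mult alpha ->
  ~ linearizable alpha f ->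
  nondeg_parabolic g ->
  ~ germ_eq (f \o g) (g \o f).
Proof.
move=> irr /holo_germ_holo0[hf fl] fa _ [/holo_germ_holo0[hg gl] [_ [q [q0 prim gq]]]].
move=> /near0P fg; apply: gq; apply/near0P.
(* The multiplier of [iter q g] is g'(0) ^ q = 1, so this iterate is tangent to the identity. *)
have [hq qD] := holo0_iter q hg gl; rewrite (prim_expr_order prim) in qD.
rewrite fa in fl.
apply: (commuting_tangent_to_id hf hq fl qD) => [|n n0|].
(* By definition [rot_mult alpha] is [expi (2 * pi * alpha)]. *)
- exact: expi_neq0.
- exact: irrational_rotation.
- exact: iter_commute.
Qed.
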